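(* Let $c\in(0,1]$ be a fixed constant. Let $A,A'\in\mathbb{R}^{n\times d}$ ($n\ge d$, $A$ of full column rank) with rows $a_i^\top$ and ${a'_i}^\top$, and suppose $A$ and $A'$ differ only in the $j$-th row, with $\|a_j-a'_j\|_2\le\epsilon_0$. Let $W_k=\mathrm{diag}(w_k)$ where $w_{k,i}\in[c,1]$ for every $i\in[n]$. Define $f(w_k,A)\in\mathbb{R}^n$ by $f(w_k,A)_i:=w_{k,i}\,a_i^\top(A^\top W_kA)^{-1}a_i$. Suppose $\epsilon_0\le c_0\,\sigma_{\min}(A)$ for a sufficiently small constant $c_0>0$. Then there exists $L=\mathrm{poly}(n,d,\kappa(A),\sigma_{\min}(A)^{-1},\sigma_{\max}(A))$ such that $$\|f(w_k,A)-f(w_k,A')\|_2\le L\cdot\epsilon_0.$$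
   Context: $\sigma_{\max}(A),\sigma_{\min}(A)$ denote the largest and smallest singular values of $A$, and $\kappa(A)=\sigma_{\max}(A)/\sigma_{\min}(A)$. $\|\cdot\|_2$ is the Euclidean norm. *)

(* Defs.v *)
From HB Require Import structures.
From mathcomp Require Import all_boot all_order all_algebra.
From mathcomp Require Import boolp classical_sets reals.
From mathcomp Require mpoly.
Set Implicit Arguments.
Unset Strict Implicit.
Unset Printing Implicit Defensive.

Import Order.TTheory GRing.Theory Num.Theory.

Local Open Scope classical_set_scope.
Local Open Scope ring_scope.

Definition norm2 (R : realType) (n : nat) (v : 'rV[R]_n) : R :=
  Num.sqrt (\sum_(i < n) v 0 i ^+ 2).

(* Singular values of a tall matrix (d <= n): the nonnegative square roots of
   the eigenvalues of A^T A. When n < d this set would also contain the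
   spurious value 0 coming from the kernel of A. *)
Definition singular_values (R : realType) (n d : nat) (A : 'M[R]_(n, d)) :
    set R :=
  [set s | 0 <= s /\ eigenvalue (A^T *m A) (s ^+ 2)].

(* The set of singular values is finite, and nonempty as soon as 0 < d, so
   that sup and inf are its maximum and minimum. *)
Definition sigma_max (R : realType) (n d : nat) (A : 'M[R]_(n, d)) : R :=
  sup (singular_values A).

Definition sigma_min (R : realType) (n d : nat) (A : 'M[R]_(n, d)) : R :=
  inf (singular_values A).

Definition kappa (R : realType) (n d : nat) (A : 'M[R]_(n, d)) : R :=
  sigma_max A / sigma_min A.

(* The rows of A are the row vectors a_i^T, so a_i is (row i A)^T. *)
Definition lev (R : realType) (n d : nat) (w : 'rV[R]_n) (A : 'M[R]_(n, d)) :
    'rV[R]_n :=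
  \row_(i < n) (w 0 i *
    (row i A *m invmx (A^T *m diag_mx w *m A) *m (row i A)^T) 0 0).

Definition poly_args (R : realType) (n d : nat) (A : 'M[R]_(n, d)) :
    'I_5 -> R :=
  tnth [tuple n%:R; d%:R; kappa A; (sigma_min A)^-1; sigma_max A].

(* Main.v *)
(** Writing [M = A^T W A], the score [w_i a_i^T M^-1 a_i] is the maximum over
    [x] of [w_i (2 a_i.x - x^T M x)], attained at [x = M^-1 a_i]. Evaluating
    the quadratic of [A'] at the maximiser of [A] (and conversely) bounds the
    change of each score by the change of the quadratic at that point. There
    [|x| <= 1 / (c sigma)] and [|a_j.x| <= 1 / c], where [sigma] is such that
    [sigma |y| <= |A y|] for all [y], so the change is [O(eps0 / (c^2 sigma))].
    The bound [sigma_min |y| <= |A y|] comes from minimising the Rayleigh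
    quotient of [A^T A] on the unit sphere, and [A'] satisfies it with
    [sigma_min / 2] as soon as [eps0 <= sigma_min / 2]. Summing over the rows,
    [L = 10 n / (c^2 sigma_min)] works. *)
Require Import Defs.
From HB Require Import structures.
From mathcomp Require Import all_boot all_order all_algebra.
From mathcomp Require Import boolp classical_sets reals.
From mathcomp Require Import topology normedtype derive.
From mathcomp Require Import lra ring.
From mathcomp Require mpoly.
(* A full import of [mpoly] would clash with the notations of [topology]. *)
Import (canonicals) mpoly.
Import Order.TTheory GRing.Theory Num.Theory.
Import numFieldNormedType.Exports.
Local Open Scope ring_scope.

(** * Euclidean inner product on row vectors *)

Section Dot.
Context {R : realType} {d : nat}.
Implicit Types u v x y : 'rV[R]_d.

Definition dot u v : R := (u *m v^T) 0 0.

Lemma dotE u v : dot u v = \sum_i u 0 i * v 0 i.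
Proof. by rewrite /dot mxE; apply: eq_bigr => i _; rewrite mxE. Qed.

Lemma dotC u v : dot u v = dot v u.
Proof. by rewrite !dotE; apply: eq_bigr => i _; rewrite mulrC. Qed.

Lemma dotDl x u v : dot (u + v) x = dot u x + dot v x.
Proof. by rewrite /dot mulmxDl mxE. Qed.

Lemma dotZl a u v : dot (a *: u) v = a * dot u v.
Proof. by rewrite /dot -scalemxAl mxE. Qed.

Lemma dot0l v : dot 0 v = 0.
Proof. by rewrite /dot mul0mx mxE. Qed.

Lemma dotNl u v : dot (- u) v = - dot u v.
Proof. by rewrite /dot mulNmx mxE. Qed.

Lemma dotBl x u v : dot (u - v) x = dot u x - dot v x.
Proof. by rewrite dotDl dotNl. Qed.

Lemma dotBr x u v : dot x (u - v) = dot x u - dot x v.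
Proof. by rewrite dotC dotBl !(dotC x). Qed.

Lemma dotDr x u v : dot x (u + v) = dot x u + dot x v.
Proof. by rewrite dotC dotDl !(dotC x). Qed.

Lemma dotZr a u v : dot u (a *: v) = a * dot u v.
Proof. by rewrite dotC dotZl dotC. Qed.

Lemma dot_ge0 u : 0 <= dot u u.
Proof. by rewrite dotE; apply: sumr_ge0 => i _; rewrite -expr2 sqr_ge0. Qed.

Lemma dot_eq0 u : dot u u = 0 -> u = 0.
Proof.
rewrite dotE => /eqP; rewrite psumr_eq0 => [/allP u0|i _]; last first.
  by rewrite -expr2 sqr_ge0.
apply/rowP => i; rewrite mxE; apply/eqP.
by have := u0 i (mem_index_enum i); rewrite -expr2 sqrf_eq0.
Qed.

Lemma sqr_norm2 u : norm2 u ^+ 2 = dot u u.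
Proof.
rewrite /norm2 sqr_sqrtr ?dotE; first by apply: eq_bigr => i _; rewrite expr2.
by apply: sumr_ge0 => i _; rewrite sqr_ge0.
Qed.

(** A sum of [d] squares is at most [d * b ^+ 2 <= (d * b) ^+ 2]. The factor [d] in place of its
    square root keeps the final constant polynomial. *)
Lemma norm2_le (b : R) v :
  (forall i, `|v 0 i| <= b) -> norm2 v <= d%:R * b.
Proof.
have [d0|d0] := posnP d.
  move=> _; rewrite /norm2 big1 ?sqrtr0 ?d0 ?mul0r// => i _.
  by have := ltn_ord i; rewrite {2}d0.
move=> vb; have b0 : 0 <= b := le_trans (normr_ge0 _) (vb (Ordinal d0)).
have nb : 0 <= d%:R * b by rewrite mulr_ge0.
rewrite /norm2 -(ger0_norm nb) -sqrtr_sqr ler_wsqrtr//.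
apply: (@le_trans _ _ (\sum_(i < d) b ^+ 2)).
  by apply: ler_sum => i _; rewrite -real_normK ?num_real// ler_sqr ?nnegrE.
rewrite sumr_const card_ord -[leLHS]mulr_natl exprMn ler_wpM2r ?sqr_ge0//.
by rewrite expr2 ler_peMl// ler1n.
Qed.

Lemma dot_CauchySchwarz u v : dot u v ^+ 2 <= dot u u * dot v v.
Proof.
have [/dot_eq0 ->|v0] := eqVneq (dot v v) 0.
  by rewrite dotC !dot0l expr0n mulr0.
have vp : 0 < dot v v by rewrite lt_def v0 dot_ge0.
(* This vector is a multiple of the component of [u] orthogonal to [v]. *)
have := dot_ge0 (dot v v *: u - dot u v *: v).
rewrite !(dotBl, dotBr, dotZl, dotZr) (dotC v u).
rewrite [X in 0 <= X](_ : _ = dot v v * (dot u u * dot v v - dot u v ^+ 2)); last by ring.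
by rewrite pmulr_rge0// subr_ge0.
Qed.

Lemma dot_mulmx_sym (M : 'M[R]_d) x y : M^T = M -> dot (x *m M) y = dot x (y *m M).
Proof. by move=> Msym; rewrite /dot trmx_mul Msym mulmxA. Qed.

End Dot.

(** * Gram matrices as weighted sums over rows *)

Section Gram.
Context {R : realType} {n d : nat}.
Implicit Types (w : 'rV[R]_n) (A : 'M[R]_(n, d)) (x y : 'rV[R]_d).

Lemma dot_gram w A x y : dot (x *m (A^T *m diag_mx w *m A)) y =
  \sum_i w 0 i * dot x (row i A) * dot y (row i A).
Proof.
rewrite /dot -!mulmxA -[A *m y^T]trmxK trmx_mul trmxK !mulmxA mxE.
apply: eq_bigr => i _.
rewrite mul_mx_diag !mxE [_ * w 0 i]mulrC; congr (_ * _ * _).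
  by apply: eq_bigr => k _; rewrite !mxE.
by apply: eq_bigr => k _; rewrite !mxE.
Qed.

Lemma gram_sym w A : (A^T *m diag_mx w *m A)^T = A^T *m diag_mx w *m A.
Proof. by rewrite !trmx_mul trmxK tr_diag_mx mulmxA. Qed.

Lemma dot_gram1 A x y : dot (x *m (A^T *m A)) y =
  \sum_i dot x (row i A) * dot y (row i A).
Proof.
rewrite -[A^T]mulmx1 -diag_const_mx dot_gram.
by apply: eq_bigr => i _; rewrite mxE mul1r.
Qed.

End Gram.

(** * Variational bound for the smallest singular value *)

Section SigmaMin.
Context {R : realType} {d : nat}.
Implicit Types (M : 'M[R]_d) (x y : 'rV[R]_d).

Lemma dot_mulmx_continuous M : continuous (fun x => dot (x *m M) x).
Proof.
rewrite (_ : (fun _ => _) =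
  fun x => \sum_i (\sum_k x 0 k * M k i) * x 0 i); last first.
  by apply/funext => x; rewrite dotE; apply: eq_bigr => i _; rewrite mxE.
apply: continuous_big => [|i _ x]; first exact: add_continuous.
apply: continuousM; last exact: coord_continuous.
apply: continuous_big => [|k _ y]; first exact: add_continuous.
by apply: continuousM; [exact: coord_continuous|exact: cst_continuous].
Qed.

(** The sphere is a level set of a continuous form, hence closed, and lies in a compact cube. *)
Lemma compact_unit_sphere : compact [set x : 'rV[R]_d | dot x x = 1]%classic.
Proof.
apply: (@subclosed_compact _ _
  [set x : 'rV[R]_d | forall i, `[-1, 1]%classic (x ord0 i)]%classic).
- rewrite (_ : mkset _ = (fun x => dot (x *m 1%:M) x) @^-1` [set 1])%classic.
    have /continuous_closedP := dot_mulmx_continuous 1%:M.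
    by apply; exact: closed_eq.
  by apply/seteqP; split=> x /=; rewrite mulmx1.
- have := @rV_compact R d (fun=> `[-1, 1]%classic).
  by apply=> i; exact: segment_compact.
- move=> x /= x1 i; rewrite /= in_itv/= -ler_norml.
  rewrite -(@expr_le1 _ 2)// real_normK ?num_real//.
  rewrite -x1 dotE (bigD1 i)//= -expr2 lerDl.
  by apply: sumr_ge0 => k _; rewrite -expr2 sqr_ge0.
Qed.

(* The minimum of the Rayleigh quotient is attained, and is an eigenvalue
   because [M - a] is then positive semidefinite and vanishes at the minimiser. *)
Lemma min_eigenvalue M : (0 < d)%N -> M^T = M ->
  exists2 a, eigenvalue M a & forall x, a * dot x x <= dot (x *m M) x.
Proof.
move=> d0 Msym.
have [z z1] : ([set x : 'rV[R]_d | dot x x = 1] !=set0)%classic.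
  exists (delta_mx 0 (Ordinal d0)) => /=.
  rewrite dotE (bigD1 (Ordinal d0))//= !mxE !eqxx mulr1 big1 ?addr0// => i ni.
  by rewrite mxE eqxx (negPf ni) mul0r.
have [||x] := @compact_EVT_min _ R (fun x => dot (x *m M) x) _ _ compact_unit_sphere.
- by exists z.
- exact/continuous_subspaceT/dot_mulmx_continuous.
rewrite inE /= => x1 xmin; set a := dot (x *m M) x.
(* By homogeneity the minimum over the sphere controls every vector. *)
have amin y : a * dot y y <= dot (y *m M) y.
  have [/dot_eq0 ->|y0] := eqVneq (dot y y) 0.
    by rewrite mul0mx dot0l mulr0.
  have yp : 0 < dot y y by rewrite lt_def y0 dot_ge0.
  have := xmin ((Num.sqrt (dot y y))^-1 *: y).
  rewrite inE /= -scalemxAl !(dotZl, dotZr) !mulrA -expr2 exprVn.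
  rewrite sqr_sqrtr ?dot_ge0// mulVf// => /(_ erefl).
  by rewrite -/a mulrC ler_pdivlMr.
exists a => //; apply/eigenvalueP; exists x; last first.
  by apply/eqP => x0; move: x1; rewrite x0 dot0l => /eqP; rewrite eq_sym oner_eq0.
apply/eqP; rewrite -subr_eq0; apply/eqP; set y := _ - _.
have yE : y = x *m M - a *: x by []; clearbody y.
apply: dot_eq0.
pose b := dot (y *m M) y - a * dot y y.
have b0 : 0 <= b by rewrite subr_ge0 amin.
have qE : dot y y = dot (x *m M) y - a * dot x y by rewrite {1}yE dotBl dotZl.
(* The form of [M - a] at [x + t *: y]; its constant term vanishes because [x] is a minimiser. *)
have key t : 0 <= t ^+ 2 * b + 2 * t * dot y y.
  rewrite [in X in _ + X]qE /b.
  have := amin (x + t *: y); rewrite -subr_ge0.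
  rewrite mulmxDl -scalemxAl !(dotDl, dotDr, dotZl, dotZr) -/a x1.
  rewrite (@dot_mulmx_sym _ _ M y x)// (dotC y (x *m M)) (dotC y x).
  by congr (0 <= _); ring.
have b1 : b + 1 != 0 by rewrite gt_eqF// ltr_wpDl.
have {}qE : dot y y = dot y y / (b + 1) * (b + 1) by rewrite divfK.
(* The denominator is [b + 1] since [b] may vanish. At [t = - e] the bound reads
   [0 <= - (b + 2) * e ^+ 2], which forces [e = 0]. *)
have := key (- (dot y y / (b + 1))); rewrite {3}qE.
move: (dot y y / (b + 1)) qE => e -> ke.
suff -> : e = 0 by rewrite mul0r.
apply/eqP; rewrite -sqrf_eq0 eq_le sqr_ge0 andbT; nra.
Qed.

(** The square root of the least eigenvalue of [A^T *m A] is a singular value, so the infimum lies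
    below it. *)
Lemma sigma_min_dot (n : nat) (A : 'M[R]_(n, d)) x : 0 <= sigma_min A ->
  sigma_min A ^+ 2 * dot x x <= \sum_i dot x (row i A) ^+ 2.
Proof.
have [d0|] := posnP d.
  move=> _; have -> : x = 0 by apply/rowP => i; have := ltn_ord i; rewrite {2}d0.
  rewrite dot0l mulr0; apply: sumr_ge0 => i _; exact: sqr_ge0.
move=> d0 s0.
have [|a /[dup] + /eigenvalueP[v vE v0] amin] := min_eigenvalue (A^T *m A) d0.
  by rewrite trmx_mul trmxK.
move=> eva.
have gE y : dot (y *m (A^T *m A)) y = \sum_i dot y (row i A) ^+ 2.
  by rewrite dot_gram1; apply: eq_bigr => i _; rewrite expr2.
have a0 : 0 <= a.
  have vp : 0 < dot v v.
    rewrite lt_def dot_ge0 andbT; apply: contraNneq v0 => /dot_eq0 ->.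
    by rewrite eqxx.
  rewrite -(pmulr_lge0 _ vp) -dotZl -vE gE.
  by apply: sumr_ge0 => i _; rewrite sqr_ge0.
have sa : sigma_min A <= Num.sqrt a.
  apply: ge_inf; first by exists 0 => t [].
  by split; rewrite ?sqrtr_ge0// sqr_sqrtr.
rewrite -gE; apply: le_trans (amin x); apply: ler_wpM2r; first exact: dot_ge0.
by rewrite -(sqr_sqrtr a0) ler_sqr ?nnegrE// sqrtr_ge0.
Qed.

End SigmaMin.

(** * Leverage scores and their one-row perturbation *)

Section Leverage.
Context {R : realType} {n d : nat}.
Implicit Types (w : 'rV[R]_n) (A : 'M[R]_(n, d)) (x : 'rV[R]_d).

(** For [s >= 0] this says [s * |x| <= |A x|]. It passes from [A] to [A'] without computing
    [sigma_min A']. *)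
Definition coercive (s : R) A :=
  forall x, s ^+ 2 * dot x x <= \sum_i dot x (row i A) ^+ 2.

Lemma le_coercive s t A : 0 <= s -> s <= t -> coercive t A -> coercive s A.
Proof.
move=> s0 st At x; apply: le_trans (At x); apply: ler_wpM2r; first exact: dot_ge0.
by rewrite ler_sqr// nnegrE (le_trans s0).
Qed.

Context (c s : R) (w : 'rV[R]_n).
Context (c0 : 0 < c) (s0 : 0 < s) (wc : forall i, c <= w 0 i <= 1).

Let w_ge0 i : 0 <= w 0 i.
Proof. by have /andP[+ _] := wc i; apply: le_trans; exact: ltW. Qed.

Lemma gram_coercive A x : coercive s A ->
  c * s ^+ 2 * dot x x <= \sum_i w 0 i * dot x (row i A) ^+ 2.
Proof.
move=> As; rewrite -mulrA; apply: le_trans (ler_wpM2l (ltW c0) (As x)) _.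
rewrite mulr_sumr; apply: ler_sum => i _; apply: ler_wpM2r; first exact: sqr_ge0.
by have /andP[] := wc i.
Qed.

Lemma dot_gram_diag A x : dot (x *m (A^T *m diag_mx w *m A)) x =
  \sum_i w 0 i * dot x (row i A) ^+ 2.
Proof. by rewrite dot_gram; apply: eq_bigr => i _; rewrite expr2 mulrA. Qed.

Lemma gram_unitmx A : coercive s A -> A^T *m diag_mx w *m A \in unitmx.
Proof.
move=> As; rewrite -row_free_unit; apply: inj_row_free => x xM0.
have := gram_coercive A x As.
rewrite -dot_gram_diag xM0 dot0l pmulr_rle0; last first.
  by rewrite mulr_gt0// exprn_gt0.
by move=> x0; apply: dot_eq0; apply/eqP; rewrite eq_le x0 dot_ge0.
Qed.

(* A leverage score is the maximum of a concave quadratic, attained at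
   [row i A *m invmx (A^T W A)]. *)
Lemma lev_max A i : coercive s A ->
  (forall x, w 0 i * (2 * dot x (row i A) - \sum_k w 0 k * dot x (row k A) ^+ 2)
     <= lev w A 0 i) /\
  exists x, lev w A 0 i = w 0 i * dot x (row i A) /\
    dot x (row i A) = \sum_k w 0 k * dot x (row k A) ^+ 2.
Proof.
move=> As; have Mu := gram_unitmx A As; set M := A^T *m _ *m A in Mu.
set y := row i A *m invmx M.
have yM : y *m M = row i A by rewrite mulmxKV.
have -> : lev w A 0 i = w 0 i * dot y (row i A) by rewrite mxE.
have yE : dot y (row i A) = \sum_k w 0 k * dot y (row k A) ^+ 2.
  by rewrite -dot_gram_diag yM dotC.
split; last by exists y.
move=> x; apply: ler_wpM2l => //; rewrite -dot_gram_diag -/M.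
(* Completing the square: this form is the gap between the values of the quadratic at [y] and at
   [x]. *)
have : 0 <= dot ((x - y) *m M) (x - y).
  rewrite dot_gram_diag; apply: sumr_ge0 => k _.
  by rewrite mulr_ge0// sqr_ge0.
rewrite mulmxBl yM !(dotBl, dotBr) (@dot_mulmx_sym _ _ M x y) ?gram_sym// yM.
rewrite !(dotC (row i A)); lra.
Qed.

(** A one-sided bound suffices, since the hypotheses are symmetric in [A] and [A']. The quadratic of
    [A'] is tested at the maximiser [x] for [A]. *)
Lemma lev_perturb_le A A' (j : 'I_n) (e : R) i :
  coercive s A -> coercive s A' -> c <= 1 ->
  (forall k, k != j -> row k A = row k A') ->
  dot (row j A - row j A') (row j A - row j A') <= e ^+ 2 ->
  0 <= e -> e <= s ->
  lev w A 0 i - lev w A' 0 i <= 5 * e / (c ^+ 2 * s).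
Proof.
move=> As As' c1 AA' de e0 es.
have [x [-> xE]] := (lev_max A i As).2.
have := (lev_max A' i As').1 x; set L' := lev w A' 0 i.
move: xE; set t := dot x (row i A) => tE.
(* Each term of a nonnegative sum is at most [t]; for [k = i] this gives [c * t ^+ 2 <= t], hence
   [c * t <= 1]. *)
have term k : w 0 k * dot x (row k A) ^+ 2 <= t.
  rewrite tE (bigD1 k)//= lerDl; apply: sumr_ge0 => l _.
  by rewrite mulr_ge0// sqr_ge0.
have t0 : 0 <= t by apply: le_trans (term i); rewrite mulr_ge0// sqr_ge0.
have ct1 : c * t <= 1.
  have := term i; rewrite -/t; have /andP[ci _] := wc i => ti.
  have [->|tn0] := eqVneq t 0; first by rewrite mulr0 ler01.
  have tp : 0 < t by rewrite lt_def tn0.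
  rewrite -(ler_pM2r tp) mul1r; apply: le_trans ti.
  by rewrite -mulrA -expr2 ler_wpM2r ?sqr_ge0.
have normx : c * s ^+ 2 * dot x x <= t by rewrite tE; exact: gram_coercive.
set b := dot x (row j A).
pose u := dot x (row j A') - b.
have cb1 : `|c * b| <= 1.
  rewrite -(@expr_le1 _ 2)// real_normK ?num_real// exprMn expr2 -mulrA.
  apply: le_trans ct1; rewrite ler_pM2l//; apply: le_trans (term j).
  by apply: ler_wpM2r; [exact: sqr_ge0|have /andP[] := wc j].
have uE : u ^+ 2 <= dot x x * e ^+ 2.
  rewrite /u /b -sqrrN opprB -dotBr; apply: le_trans (dot_CauchySchwarz _ _) _.
  by rewrite ler_wpM2l// dot_ge0.
have csu : `|c * s * u| <= e.
  rewrite -(@ler_pXn2r _ 2) ?nnegrE// real_normK ?num_real//.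
  rewrite exprMn exprMn; apply: (@le_trans _ _ (c * (c * s ^+ 2 * dot x x) * e ^+ 2)).
    apply: (@le_trans _ _ (c ^+ 2 * s ^+ 2 * (dot x x * e ^+ 2))).
      by rewrite ler_wpM2l// mulr_ge0// sqr_ge0.
    by rewrite le_eqVlt; apply/orP; left; apply/eqP; ring.
  rewrite -[leRHS]mul1r ler_wpM2r ?sqr_ge0//; apply: le_trans ct1.
  by rewrite ler_pM2l.
(* Only row [j] contributes to the change, where [b] becomes [b + u]. *)
have Q' : \sum_k w 0 k * dot x (row k A') ^+ 2 = t + w 0 j * (2 * b * u + u ^+ 2).
  rewrite tE (bigD1 j)//= [in RHS](bigD1 j)//= -/b.
  rewrite (eq_bigr (fun k => w 0 k * dot x (row k A) ^+ 2)) => [|k kj].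
    by rewrite /u; ring.
  by rewrite AA'.
have ti' : dot x (row i A') - t = (i == j)%:R * u.
  have [ij|ij] := eqVneq i j; first by rewrite mul1r /t /u /b ij.
  by rewrite /t AA'// subrr mul0r.
rewrite Q'.
set D := e / (c * s).
have cs0 : 0 < c * s by rewrite mulr_gt0.
have uD : `|u| <= D.
  by rewrite ler_pdivlMr// mulrC -[c * s]gtr0_norm// -normrM.
have D0 : 0 <= D := le_trans (normr_ge0 _) uD.
have Dc : D <= c^-1 by rewrite /D ler_pdivrMr// mulKf ?gt_eqF.
have bc : `|b| <= c^-1.
  by rewrite -[c^-1]mul1r ler_pdivlMr// mulrC -{1}[c]gtr0_norm// -normrM.
have cV1 : 1 <= c^-1 by rewrite invf_ge1.
(* Here [e <= s] enters through [D <= c^-1], which gives [|2 * b + u| <= 3 / c]. The linear part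
   adds [2 * D / c], whence the factor 5. *)
have quad : w 0 j * (2 * b * u + u ^+ 2) <= 3 * c^-1 * D.
  apply: le_trans (ler_norm _) _; rewrite normrM ger0_norm//.
  rewrite -[leRHS]mul1r; apply: ler_pM => //; first by have /andP[] := wc j.
  rewrite (_ : _ + _ = (2 * b + u) * u); last by ring.
  rewrite normrM; apply: ler_pM => //; apply: le_trans (ler_normD _ _) _.
  rewrite normrM normr_nat; lra.
have lin : - (2 * (dot x (row i A') - t)) <= 2 * c^-1 * D.
  apply: (@le_trans _ _ (2 * D)); last by rewrite ler_wpM2r//; lra.
  rewrite ti' -mulrN ler_pM2l//; apply: le_trans (ler_norm _) _; rewrite normrN.
  by case: (i == j); rewrite ?mul1r// mul0r normr0.
have -> : 5 * e / (c ^+ 2 * s) = 5 * c^-1 * D.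
  by rewrite /D; field; rewrite !gt_eqF.
have /andP[_ wi1] := wc i.
move=> lowL'.
have step : w 0 i * (- (2 * (dot x (row i A') - t)) +
    w 0 j * (2 * b * u + u ^+ 2)) <= 5 * c^-1 * D.
  apply: (@le_trans _ _ (w 0 i * (5 * c^-1 * D))).
    by rewrite ler_wpM2l//; lra.
  by rewrite ler_piMl// !mulr_ge0// invr_ge0 ltW.
apply: le_trans step; rewrite lerBlDr -lerBlDl; apply: le_trans lowL'.
by rewrite le_eqVlt; apply/orP; left; apply/eqP; ring.
Qed.

End Leverage.

(** * Choice of constants and summation over the scores *)

Theorem mainTheorem2 (R : realType) (c : R) (hc : 0 < c <= 1) :
  exists c0 : R, 0 < c0 < 1 /\
  exists p : mpoly.mpoly 5 R,
  forall (n d : nat) (A A' : 'M[R]_(n, d)) (j : 'I_n) (eps0 : R)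
    (w : 'rV[R]_n),
    (d <= n)%N ->
    \rank A = d ->
    (forall i : 'I_n, i != j -> row i A = row i A') ->
    norm2 (row j A - row j A') <= eps0 ->
    (forall i : 'I_n, c <= w 0 i <= 1) ->
    eps0 <= c0 * sigma_min A ->
    exists L : R,
      L = mpoly.meval (poly_args A) p /\
      norm2 (lev w A - lev w A') <= L * eps0.
Proof.
have /andP[c0 c1] := hc.
exists 2^-1; split; first by apply/andP; split; lra.
(* Variables 0 and 3 evaluate to [n] and [(sigma_min A)^-1]. *)
exists (mpoly.mpolyC 5 (10 / c ^+ 2) * mpoly.mpolyX R (mpoly.mnm1 ord0)
        * mpoly.mpolyX R (mpoly.mnm1 (inord 3))).
move=> n d A A' j e w _ _ AA' Aje wc es; eexists; split; first by [].
rewrite !mpoly.mevalM mpoly.mevalC !mpoly.mevalXU /poly_args.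
rewrite !(tnth_nth 0) inordK//=.
have e0 : 0 <= e by apply: le_trans Aje; exact: sqrtr_ge0.
have de : dot (row j A - row j A') (row j A - row j A') <= e ^+ 2.
  by rewrite -sqr_norm2 ler_sqr ?nnegrE// sqrtr_ge0.
(* In this degenerate case [e = 0], so the matrices coincide. *)
have [s0|s0] := leP (sigma_min A) 0.
  have e00 : e = 0 by apply/eqP; rewrite eq_le e0 andbT; lra.
  have -> : A = A'.
    apply/row_matrixP => i; have [->|/AA'//] := eqVneq i j.
    apply/eqP; rewrite -subr_eq0; apply/eqP/dot_eq0/eqP.
    by rewrite eq_le dot_ge0 andbT; move: de; rewrite e00 expr0n.
  rewrite subrr e00 mulr0 /norm2 big1 ?sqrtr0// => i _.
  by rewrite mxE expr0n.
set s := sigma_min A in es s0 *.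
have As : coercive s A by move=> x; apply: sigma_min_dot; exact: ltW.
have h0 : 0 < s / 2 by rewrite divr_gt0.
have hA : coercive (s / 2) A by apply: (@le_coercive _ _ _ _ s) => //; lra.
have hA' : coercive (s / 2) A'.
  move=> x; have := As x.
  have xj : dot x (row j A - row j A') ^+ 2 <= (s / 2) ^+ 2 * dot x x.
    apply: le_trans (dot_CauchySchwarz _ _) _; rewrite mulrC ler_wpM2r ?dot_ge0//.
    by apply: le_trans de _; rewrite ler_sqr ?nnegrE//; lra.
  rewrite (bigD1 j)//= [X in _ -> _ <= X](bigD1 j)//= => sx.
  have rest : \sum_(i < n | i != j) dot x (row i A) ^+ 2 =
              \sum_(i < n | i != j) dot x (row i A') ^+ 2.
    by apply: eq_bigr => i /AA' ->.
  have rest0 : 0 <= \sum_(i < n | i != j) dot x (row i A') ^+ 2.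
    by apply: sumr_ge0 => i _; exact: sqr_ge0.
  rewrite rest in sx; move: xj sx rest0; rewrite dotBr.
  move: (\sum_(i < n | i != j) _) (dot x (row j A)) (dot x (row j A')) (dot x x).
  (* Follows from [a ^+ 2 <= 2 * a' ^+ 2 + 2 * (a - a') ^+ 2] and [S <= 2 * S]. *)
  move=> S a a' q aa' sq S0; nra.
have es2 : e <= s / 2 by lra.
have -> : 10 / c ^+ 2 * n%:R * s^-1 * e = n%:R * (5 * e / (c ^+ 2 * (s / 2))).
  by field; rewrite !gt_eqF.
apply: norm2_le => i; rewrite !mxE ler_norml lerNl opprB.
have := lev_perturb_le c (s / 2) w c0 h0 wc A A' j e i hA hA' c1 AA' de e0 es2.
have := lev_perturb_le c (s / 2) w c0 h0 wc A' A j e i hA' hA c1.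
rewrite !mxE => lo hi; apply/andP; split; last exact: hi.
apply: lo => // [k /AA'//|].
by rewrite -opprB dotNl dotC dotNl opprK.
Qed.
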